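(* Let $n,k\ge1$, $\sigma>0$, let $X\in\mathbb{R}^{n\times k}$ be fixed, let $Y$ be a random $n\times k$ matrix with independent entries $Y_{i,j}\sim\mathcal{N}(X_{i,j},\sigma^2)$, and let $P\in\mathbb{R}^{n\times n}$ and $Q\in\mathbb{R}^{k\times k}$ be orthogonal matrices. For $\Theta\in\mathbb{R}^{n\times k}$ let $f_\Theta(Y)=P^{-1}(\Theta\odot(PYQ))Q^{-1}$ and $\mathcal{R}_\Theta(X)=\mathbb{E}\|f_\Theta(Y)-X\|_F^2$. Then $$\mathop{\arg\min}_{\Theta\in\mathbb{R}^{n\times k}}\mathcal{R}_\Theta(X)=\frac{(PXQ)^{\odot2}}{\sigma^2+(PXQ)^{\odot2}} .$$
   Context: $\odot$ is the entrywise (Hadamard) product and $A^{\odot2}=A\odot A$. The addition of the scalar $\sigma^2$ and the division are entrywise. $\|\cdot\|_F$ is the Frobenius norm. *)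

(* Defs.v *)
From HB Require Import structures.
From mathcomp Require Import all_boot all_order all_algebra.
From mathcomp Require Import all_classical all_reals all_analysis.

Set Implicit Arguments.
Unset Strict Implicit.
Unset Printing Implicit Defensive.

Import Order.TTheory GRing.Theory Num.Theory.
Import numFieldNormedType.Exports.

Local Open Scope classical_set_scope.
Local Open Scope ring_scope.

Definition hadamard (R : realType) (m n : nat) (A B : 'M[R]_(m, n)) :
    'M[R]_(m, n) :=
  map2_mx *%R A B.

Definition hdiv (R : realType) (m n : nat) (A B : 'M[R]_(m, n)) :
    'M[R]_(m, n) :=
  map2_mx (fun a b => a / b) A B.

Definition orthogonal_matrix (R : realType) (n : nat) (A : 'M[R]_n) : Prop :=
  A *m A^T = 1%:M /\ A^T *m A = 1%:M.

(* The norm `|A| of the library is the maximum of the absolute values of the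
   entries, hence a separate definition. *)
Definition frobenius_norm (R : realType) (m n : nat) (A : 'M[R]_(m, n)) : R :=
  Num.sqrt (\sum_i \sum_j A i j ^+ 2).

Definition mutually_independent (d : measure_display) (T : measurableType d)
    (R : realType) (Pr : probability T R) (I : finType)
    (Z : I -> {RV Pr >-> R}) : Prop :=
  forall (J : {set I}) (B : I -> set R), (forall i, measurable (B i)) ->
    Pr (\bigcap_(i in [set i | i \in J]) (Z i @^-1` B i)) =
    (\prod_(i in J) Pr (Z i @^-1` B i))%E.

(* sigma is the standard deviation, as in normal_prob.  The two set functions
   are compared on measurable sets only: their values elsewhere carry no
   meaning. *)
Definition has_normal_law (d : measure_display) (T : measurableType d)
    (R : realType) (Pr : probability T R) (Z : {RV Pr >-> R}) (mu sigma : R) :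
    Prop :=
  forall B : set R, measurable B ->
    distribution Pr Z B = normal_prob mu sigma B.

(* A random matrix is given by the family of its entries; this is its value at
   the outcome w. *)
Definition sample_matrix (d : measure_display) (T : measurableType d)
    (R : realType) (Pr : probability T R) (n k : nat)
    (Y : 'I_n * 'I_k -> {RV Pr >-> R}) (w : T) : 'M[R]_(n, k) :=
  \matrix_(i, j) Y (i, j) w.

Definition filter_estimator (R : realType) (n k : nat)
    (P : 'M[R]_n) (Q : 'M[R]_k) (Theta M : 'M[R]_(n, k)) : 'M[R]_(n, k) :=
  invmx P *m hadamard Theta (P *m M *m Q) *m invmx Q.

Definition risk (d : measure_display) (T : measurableType d)
    (R : realType) (Pr : probability T R) (n k : nat)
    (Y : 'I_n * 'I_k -> {RV Pr >-> R}) (P : 'M[R]_n) (Q : 'M[R]_k)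
    (X Theta : 'M[R]_(n, k)) : \bar R :=
  'E_Pr[fun w =>
    (frobenius_norm (filter_estimator P Q Theta (sample_matrix Y w) - X) ^+ 2)%R]%E.

Definition argmin (S : Type) (R : realType) (F : S -> \bar R) : set S :=
  [set s | forall t, (F s <= F t)%E].

(* Main.v *)
(* By orthogonality of [P] and [Q] the loss is the sum over the entries of
   [(Theta_ij (PYQ)_ij - z_ij)^2] with [z = PXQ]. The entry [(PYQ)_ij] is a
   combination of uncorrelated variables of variance [sigma^2] whose
   coefficients have square sum 1, so it has mean [z_ij] and variance [sigma^2].
   The risk is therefore the sum of the
   [Theta_ij^2 sigma^2 + (Theta_ij - 1)^2 z_ij^2], and completing the square in
   each entry gives the unique minimiser. *)
From HB Require Import structures.
Require Import Defs.
From mathcomp Require Import all_boot all_order all_algebra.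
From mathcomp Require Import ring.
From mathcomp Require Import all_classical all_reals all_analysis.
From mathcomp Require Import measurable_realfun.

Import Order.TTheory GRing.Theory Num.Theory.
Import numFieldNormedType.Exports.

Local Open Scope classical_set_scope.
Local Open Scope ring_scope.

(** * Moments of the normal distribution *)

Section normal_moments.
Context (R : realType).
Local Notation mu := (@lebesgue_measure R).
Implicit Types (m s : R).

(** The Radon-Nikodym derivative of [normal_prob m s] and the explicit density have the same
    integral over every measurable set, hence agree almost everywhere; the change of variables
    formula for the former then holds for the latter. *)
Lemma ge0_integral_normal_prob m s (f : R -> \bar R) :
    measurable_fun [set: R] f -> (forall x, 0 <= f x)%E ->
  (\int[normal_prob m s]_x f x =
   \int[mu]_x (f x * (normal_pdf m s x)%:E))%E.
Proof.
move=> mf f0; have dom := @normal_prob_dominates R m s.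
rewrite -(Radon_Nikodym_SigmaFinite.change_of_variables dom)//.
have mRN : mu.-integrable [set: R]
    (Radon_Nikodym_SigmaFinite.f (normal_prob m s) mu).
  exact: Radon_Nikodym_SigmaFinite.f_integrable.
apply: ae_eq_integral => //.
- by apply: emeasurable_funM => //; exact: measurable_int mRN.
- apply: emeasurable_funM => //.
  by apply/measurable_EFinP; exact: measurable_normal_pdf.
- apply: ae_eqe_mul2l; apply: integral_ae_eq => //.
  + by apply/measurable_EFinP; exact: measurable_normal_pdf.
  + by move=> A _ mA; rewrite -Radon_Nikodym_SigmaFinite.f_integral.
Qed.

Lemma normal_pdf_center m s x : s != 0 ->
  normal_pdf m s x = normal_pdf 0 s (x - m).
Proof. by move=> s0; rewrite !normal_pdfE// normal_fun_center. Qed.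

Lemma normal_pdf0N s x : s != 0 -> normal_pdf 0 s (- x) = normal_pdf 0 s x.
Proof. by move=> s0; rewrite !normal_pdfE// /normal_fun !subr0 sqrrN. Qed.

(** Translation invariance of Lebesgue measure, obtained by substituting along the increasing map
    [x - m] of derivative 1. *)
Lemma ge0_integral_center m (G : R -> R) :
    continuous G -> (forall x, 0 <= G x) ->
  (\int[mu]_x (G (x - m))%:E = \int[mu]_x (G x)%:E)%E.
Proof.
move=> cG G0; pose F (x : R^o) := x - m.
have F'E : F^`()%classic = cst 1.
  apply/funext => x; rewrite /F derive1E deriveD// derive_cst.
  by rewrite derive_id addr0.
rewrite (@increasing_ge0_integration_by_substitutionT _ F G)//.
- by apply: eq_integral => x _; rewrite F'E !fctE mulr1.
- by move=> x y xy; rewrite /F ltrD2r.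
- by rewrite F'E => ?; exact: cvg_cst.
- by rewrite F'E; exact: is_cvg_cst.
- by rewrite F'E; exact: is_cvg_cst.
- exact: cvg_addrr_Ny.
- exact: cvg_addrr.
Qed.

(** Translation by [m] carries the density of mean [m] to the centred one, so central moments need
    only be computed for mean 0. *)
Lemma ge0_integral_normal_center m s (G : R -> R) : s != 0 ->
    continuous G -> (forall x, 0 <= G x) ->
  (\int[normal_prob m s]_x (G (x - m))%:E =
   \int[mu]_x (G x * normal_pdf 0 s x)%:E)%E.
Proof.
move=> s0 cG G0.
have mG := continuous_measurable_fun cG.
rewrite ge0_integral_normal_prob; first last.
- by move=> x; rewrite lee_fin.
- apply/measurable_EFinP; apply: (measurableT_comp mG).
  exact: measurable_funB.
rewrite -(ge0_integral_center m (fun x => G x * normal_pdf 0 s x)).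
- by apply: eq_integral => x _; rewrite -EFinM -normal_pdf_center.
- by move=> x; apply: cvgM; [exact: cG|exact: continuous_normal_pdf].
- by move=> x; rewrite mulr_ge0 ?normal_pdf_ge0.
Qed.

Lemma ge0_integral0y_derive (f F : R -> R) (l : R) :
    (forall x, 0 <= x -> 0 <= f x) -> continuous f ->
    (forall x : R, is_derive x 1 F (f x)) -> F x @[x --> +oo] --> l ->
  (\int[mu]_(x in `[0%R, +oo[) (f x)%:E = (l - F 0)%:E)%E.
Proof.
move=> f0 cf dF Fl; rewrite EFinB; apply: ge0_continuous_FTC2y => //.
- exact: continuous_subspaceT.
- apply: cvg_at_right_filter.
  by apply: differentiable_continuous; apply/derivable1_diffP.
- by move=> x _; rewrite derive1E; apply: derive_val.
Qed.

(** This drives the integration by parts: it makes [- s^2 x phi(x)] an antiderivative of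
    [(x^2 - s^2) phi(x)], where [phi] is the centred density. *)
Lemma is_derive_normal_pdf0 s (x : R) : s != 0 ->
  is_derive x 1 (normal_pdf 0 s) (- (x / s ^+ 2) * normal_pdf 0 s x).
Proof.
move=> s0; rewrite normal_pdfE//.
have -> : (fun x => normal_peak s * normal_fun 0 s x) =
    normal_peak s \*: (expR \o (- ((s ^+ 2 *+ 2)^-1 \*: (@id R ^+ 2)))).
  apply/funext => y; rewrite /= /normal_fun subr0 !fctE /GRing.scale/=.
  by congr (_ * expR _); rewrite mulrC mulrN.
apply: is_derive_eq.
rewrite !fctE /= /normal_fun subr0 /GRing.scale/= expr1 mulr1.
by rewrite [- x ^+ 2 / _]mulrC [_ * - x ^+ 2]mulrN; field.
Qed.

(** The boundary term at infinity of the integration by parts. With [y = x^2 / (2 s^2)], the bound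
    [y <= exp y] gives [exp (- y) <= 1 / y], so the product is at most a constant over [x]. *)
Lemma cvg_id_normal_pdf0 s : 0 < s -> x * normal_pdf 0 s x @[x --> +oo] --> 0.
Proof.
move=> s0; have sN0 : s != 0 by rewrite gt_eqF.
apply: (@squeeze_cvgr _ _ _ _ (cst 0)
  (fun x => (2 * s ^+ 2 * normal_peak s) * x^-1)).
- near=> x; have x0 : 0 < x by near: x; exact: nbhs_pinfty_gt.
  rewrite /= mulr_ge0 ?normal_pdf_ge0 ?(ltW x0)//=.
  rewrite normal_pdfE// /normal_fun subr0 mulNr expRN -mulr_natl.
  set y := x ^+ 2 / _.
  have y0 : 0 < y by rewrite divr_gt0 ?mulr_gt0 ?exprn_gt0.
  have yexp : y <= expR y by rewrite (le_trans _ (expR_ge1Dx _))// lerDr.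
  apply: (@le_trans _ _ (x * (normal_peak s * y^-1))).
    rewrite ler_pM2l// ler_wpM2l ?normal_peak_ge0//.
    by rewrite lef_pV2 ?posrE ?expR_gt0.
  rewrite /y le_eqVlt; apply/predU1P; left; field.
  by rewrite sN0 gt_eqF.
- exact: cvg_cst.
- rewrite -[X in _ --> X](mulr0 (2 * s ^+ 2 * normal_peak s)).
  apply: cvgM; first exact: cvg_cst.
  apply/gtr0_cvgV0; last exact: cvg_id.
  exact: nbhs_pinfty_gt.
Unshelve. all: by end_near. Qed.

Lemma integral0y_sqr_normal_pdf s : 0 < s ->
  (\int[mu]_(x in `[0%R, +oo[) (x ^+ 2 * normal_pdf 0 s x)%:E =
   (s ^+ 2)%:E * \int[mu]_(x in `[0%R, +oo[) (normal_pdf 0 s x)%:E)%E.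
Proof.
move=> s0; have sN0 : s != 0 by rewrite gt_eqF.
pose phi := normal_pdf 0 s.
(* [C] is chosen so that [C exp(-x) >= s^2 phi(x)] on [[0, s]]: there [phi] is at most its peak and
   [exp(s - x) >= 1]. Beyond [s] the factor [x^2 - s^2] is nonnegative by itself. *)
pose C := s ^+ 2 * normal_peak s * expR s.
have C0 : 0 <= C.
  by rewrite mulr_ge0 ?expR_ge0// mulr_ge0 ?normal_peak_ge0// sqr_ge0.
have cphi : continuous phi by exact: continuous_normal_pdf.
have cexp : continuous (fun x : R => expR (- x)).
  move=> x; apply: continuous_comp; first exact: opp_continuous.
  exact: continuous_expR.
have csqr : continuous (fun x : R => x ^+ 2) by exact: exprn_continuous.
have mphi : measurable_fun [set: R] phi by exact: measurable_normal_pdf.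
have mexp := continuous_measurable_fun cexp.
have msqr := continuous_measurable_fun csqr.
have phi0 x : 0 <= phi x by exact: normal_pdf_ge0.
have dphi x := is_derive_normal_pdf0 s x sN0.
(* [f] has the antiderivative [- s^2 x phi(x) - C exp(-x)]; the term in
   [exp(-x)] makes [f] nonnegative, as the library has FTC2 on [[0, +oo[] only
   for functions of constant sign. *)
pose f (x : R) : R := (x ^+ 2 - s ^+ 2) * phi x + C * expR (- x).
have f_ge0 (x : R) : 0 <= x -> 0 <= f x.
  move=> x0; have [xs|sx] := leP x s; last first.
    apply: addr_ge0; apply: mulr_ge0; rewrite ?expR_ge0// subr_ge0.
    by rewrite ler_sqr ?nnegrE ?(ltW s0) ?(ltW sx).
  rewrite /f mulrBl -addrA; apply: addr_ge0.
    by apply: mulr_ge0; [exact: sqr_ge0|exact: phi0].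
  rewrite addrC subr_ge0 (_ : C * _ =
    s ^+ 2 * (normal_peak s * (expR s * expR (- x)))); last by rewrite /C; ring.
  apply: ler_wpM2l; first exact: sqr_ge0.
  apply: (le_trans (normal_pdf_ub _ _ sN0)).
  rewrite ler_peMr ?normal_peak_ge0//.
  by rewrite -expRD -expR0 ler_expR subr_ge0.
pose E (x : R) : R := C * expR (- x).
have cE : continuous E by move=> x; apply: cvgM; [exact: cvg_cst|exact: cexp].
have dE (x : R) : is_derive x 1 (- E) (E x).
  have -> : - E = - (C \*: (expR \o -%R)) by [].
  by apply: is_derive_eq; rewrite /E /= /GRing.scale/=; ring.
have Ey : (- E) x @[x --> +oo] --> (0 : R).
  rewrite -[X in _ --> X](_ : - (C * 0) = 0); last by ring.
  by apply: cvgN; apply: cvgM; [exact: cvg_cst|exact: cvgr_expR].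
have intE : (\int[mu]_(x in `[0%R, +oo[) (E x)%:E = C%:E)%E.
  rewrite (ge0_integral0y_derive E (- E) 0 _ cE dE Ey).
    by rewrite !fctE /E oppr0 expR0 mulr1 sub0r opprK.
  by move=> x _; rewrite mulr_ge0 ?expR_ge0.
pose F : R -> R := (- s ^+ 2) \*: (@id R * phi) - E.
have cf : continuous f.
  move=> x; apply: cvgD; last exact: cE.
  by apply: cvgM; [apply: cvgB; [exact: csqr|exact: cvg_cst]|exact: cphi].
have dF (x : R) : is_derive x 1 F (f x).
  by apply: is_derive_eq; rewrite /f /= /GRing.scale/= -/phi /E; field.
have Fy : F x @[x --> +oo] --> (0 : R).
  rewrite -[X in _ --> X](_ : - s ^+ 2 * 0 + 0 = 0); last by ring.
  apply: cvgD Ey; apply: cvgM; first exact: cvg_cst.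
  exact: cvg_id_normal_pdf0.
have intf : (\int[mu]_(x in `[0%R, +oo[) (f x)%:E = C%:E)%E.
  rewrite (ge0_integral0y_derive f F 0 f_ge0 cf dF Fy).
  by rewrite /F !fctE /E /= oppr0 expR0 mul0r scaler0 mulr1 !sub0r opprK.
have mI : measurable (`[0%R, +oo[%classic : set R) by [].
(* The finite constant [C] is added to both sides, as the integral of [E] on the left and of [f] on
   the right. The integrands then agree pointwise: [x^2 phi + E = s^2 phi + f]. *)
rewrite -[LHS](@addeK _ C%:E)// -[RHS](@addeK _ C%:E)//; congr (_ - _)%E.
rewrite -{1}intE -intf.
rewrite -ge0_integralD//=; last 4 first.
- by move=> x _; rewrite lee_fin mulr_ge0 ?sqr_ge0.
- by apply/measurable_EFinP/measurable_funTS/measurable_funM.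
- by move=> x _; rewrite lee_fin mulr_ge0 ?expR_ge0.
- by apply/measurable_EFinP/measurable_funTS/measurable_funM.
rewrite -ge0_integralZl//=; last 3 first.
- by apply/measurable_EFinP/measurable_funTS.
- by move=> x _; rewrite lee_fin.
- by rewrite lee_fin sqr_ge0.
rewrite -ge0_integralD//=; last 4 first.
- by move=> x _; rewrite mule_ge0 ?lee_fin ?sqr_ge0.
- by apply/measurable_funTS/measurable_EFinP/measurable_funM.
- by move=> x; rewrite in_itv/= andbT lee_fin => /f_ge0.
- apply/measurable_EFinP/measurable_funTS.
  apply: measurable_funD; apply: measurable_funM => //.
  exact: measurable_funB.
apply: eq_integral => x _; rewrite -EFinM -!EFinD /f /E; congr EFin.
by rewrite -/phi; ring.
Qed.

Lemma ge0_integral_even_normal_pdf s (G : R -> R) : s != 0 ->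
    continuous G -> (forall x, 0 <= G x) -> (forall x, G (- x) = G x) ->
  (\int[mu]_x (G x * normal_pdf 0 s x)%:E =
   2%:E * \int[mu]_(x in `[0%R, +oo[) (G x * normal_pdf 0 s x)%:E)%E.
Proof.
move=> s0 cG G0 GN; rewrite ge0_symfun_integralT ?set_itvcy//.
- by move=> x; rewrite mulr_ge0 ?normal_pdf_ge0.
- by move=> x; apply: cvgM; [exact: cG|exact: continuous_normal_pdf].
- by move=> x /=; rewrite GN normal_pdf0N.
Qed.

Lemma integral_sqr_normal_prob m s : 0 < s ->
  (\int[normal_prob m s]_x ((x - m) ^+ 2)%:E = (s ^+ 2)%:E)%E.
Proof.
move=> s0; have sN0 : s != 0 by rewrite gt_eqF.
rewrite (ge0_integral_normal_center m s (fun x => x ^+ 2))//; last 2 first.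
- exact: exprn_continuous.
- by move=> x; exact: sqr_ge0.
rewrite (ge0_integral_even_normal_pdf s (fun x => x ^+ 2))//; last 3 first.
- exact: exprn_continuous.
- by move=> x; exact: sqr_ge0.
- by move=> x; exact: sqrrN.
rewrite integral0y_sqr_normal_pdf// muleCA.
(* For [G = 1] the formula for even functions says that twice the mass of the half-line is the total
   mass 1. *)
have := ge0_integral_even_normal_pdf s (cst 1) sN0.
rewrite /cst /=.
under eq_integral do rewrite mul1r.
under [X in (2%:E * X)%E]eq_integral do rewrite mul1r.
rewrite integral_normal_pdf => <-//; first by rewrite mule1.
by move=> x; exact: cvg_cst.
Qed.

(* Stated with nonnegative integrands; for an integrable variable it says that
   the first central moment vanishes. *)
Lemma integral_addr_norm_normal_prob m s : 0 < s ->
  (\int[normal_prob m s]_x (x - m + `|x - m|)%:E =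
   \int[normal_prob m s]_x (`|x - m|)%:E)%E.
Proof.
move=> s0; have sN0 : s != 0 by rewrite gt_eqF.
have cabs : continuous (fun x : R => `|x|) by exact: norm_continuous.
have c1 : continuous (fun x : R => x + `|x|).
  by move=> x; apply: cvgD; [exact: cvg_id|exact: cabs].
have p1 x : 0 <= x + `|x| :> R by rewrite -lerBlDl sub0r -normrN ler_norm.
rewrite (ge0_integral_normal_center m s (fun x => x + `|x|))//.
rewrite (ge0_integral_normal_center m s (fun x => `|x|))//.
rewrite (ge0_integral_even_normal_pdf s (fun x => `|x|))//; last first.
  by move=> x; exact: normrN.
have mphi := @measurable_normal_pdf R 0 s.
rewrite -ge0_integralZl//=; last 2 first.
- by apply/measurable_EFinP; apply: measurable_funTS; apply: measurable_funM.
- by move=> x _; rewrite lee_fin mulr_ge0 ?normal_pdf_ge0.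
(* The function [x + |x|] is [2 |x|] on the half-line and 0 to its left, so both sides are twice the
   integral of [|x| phi(x)] over the half-line. *)
rewrite [RHS]integral_mkcond; apply: eq_integral => x _.
rewrite patchE mem_setE in_itv/= andbT; case: ifPn => [x0|].
  by rewrite ger0_norm// -EFinM; congr EFin; ring.
by rewrite -ltNge => x0; rewrite ltr0_norm// subrr mul0r.
Qed.

End normal_moments.

(** * Expectation of a product of independent variables *)

Section independence.
Context d (T : measurableType d) (R : realType) (Pr : probability T R).
Implicit Types U V : {RV Pr >-> R}.

(* Independence says that the law of [(U, V)] is the product of the laws, and
   the claim is then Fubini's theorem. *)
Lemma expectationM_indep U V :
    (forall A B : set R, measurable A -> measurable B ->
      Pr (U @^-1` A `&` V @^-1` B) = (Pr (U @^-1` A) * Pr (V @^-1` B))%E) ->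
    (U : T -> R) \in Lfun Pr 1%E -> (V : T -> R) \in Lfun Pr 1%E ->
    (U * V : T -> R) \in Lfun Pr 1%E ->
  ('E_Pr[U * V] = 'E_Pr[U] * 'E_Pr[V])%E.
Proof.
move=> UV /Lfun1_integrable iU /Lfun1_integrable iV /Lfun1_integrable iUV.
pose h w := (U w, V w).
have mh : measurable_fun [set: T] h by exact: measurable_fun_pair.
pose hM := isMeasurableFun.Build _ _ _ _ h mh.
pose H : {mfun T >-> _} := HB.pack h hM.
pose law := distribution Pr H.
pose mU := distribution Pr U.
pose mV := distribution Pr V.
pose f (z : R * R) := (z.1 * z.2)%:E.
have mf : measurable_fun [set: R * R] f.
  by apply/measurable_EFinP; exact: measurable_funM.
(* Independence gives agreement on rectangles, and these determine the product measure. *)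
have lawE (A : set (R * R)) : measurable A -> (mU \x mV)%E A = law A.
  by apply: product_measure_unique => B C mB mC; exact: UV.
have ilaw : law.-integrable [set: R * R] f.
  exact: integrable_pushforward.
have ifUV : (mU \x mV)%E.-integrable [set: R * R] f.
  case/integrableP: ilaw => _ ?; apply/integrableP; split => //.
  by rewrite (eq_measure_integral law)// => A mA _; exact: lawE.
rewrite unlock.
transitivity (\int[law]_z f z)%E; first by rewrite integral_distribution.
rewrite (eq_measure_integral (mU \x mV)%E); last first.
  by move=> A mA _; exact/esym/lawE.
rewrite -integral12_prod_meas1// /fubini_F /f /=.
have EU : (\int[mU]_x x%:E = \int[Pr]_w (U w)%:E)%E.
  by rewrite integral_distribution.
have EV : (\int[mV]_x x%:E = \int[Pr]_w (V w)%:E)%E.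
  by rewrite integral_distribution.
have iid (W : {RV Pr >-> R}) : Pr.-integrable [set: T] (EFin \o W) ->
    (distribution Pr W).-integrable [set: R] (@EFin R).
  by move=> iW; apply: integrable_pushforward.
have iidV := iid V iV; have iidU := iid U iU.
transitivity (\int[mU]_x (x%:E * \int[mV]_y y%:E))%E.
  apply: eq_integral => x _; under eq_integral do rewrite EFinM.
  by rewrite integralZl.
(* The inner integral is finite by integrability of [V]; written as a real number, it can be taken
   out of the outer integral. *)
rewrite EV -EU -(@fineK _ (\int[Pr]_w (V w)%:E)%E); last first.
  exact: integrable_fin_num.
by rewrite integralZr.
Qed.

End independence.

(** * Square-integrable variables and their affine images *)

Section square_integrable.
Context d (T : measurableType d) (R : realType).

Lemma sqr_integral_lty_Lfun2 (mu : {measure set T -> \bar R}) (f : T -> R) :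
    measurable_fun [set: T] f -> (\int[mu]_x (f x ^+ 2)%:E < +oo)%E ->
  f \in Lfun mu 2%:E.
Proof.
move=> mf foo; rewrite inE; apply/andP; split; rewrite inE//=.
rewrite /finite_norm unlock /Lnorm poweR_lty//.
under eq_integral do rewrite /= powR_mulrn// real_normK ?num_real//.
exact: foo.
Qed.

Context (Pr : probability T R).

Lemma Lfun2_subset1 (f : T -> R) : f \in Lfun Pr 2%:E -> f \in Lfun Pr 1%E.
Proof. exact: (Lfun_subset12 (fin_num_measure Pr _ measurableT)). Qed.

Lemma Lfun2_affine (f : T -> R) (a b : R) :
  f \in Lfun Pr 2%:E -> (a \o* f) \+ cst b \in Lfun Pr 2%:E.
Proof.
move=> f2; apply: (Lfun_addr_closed Pr (lee1n 2)).2; last exact: Lfun_cst.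
by apply: Lfun_scale => //; rewrite ler1n.
Qed.

(** The second moment of [U = a f - b] is its variance plus the square of its mean. Applied to an
    entry of the estimator, this splits the error into variance and squared bias. *)
Lemma expectation_sqr_affine (f : T -> R) (a b m v : R) :
    f \in Lfun Pr 2%:E -> 'E_Pr[f]%E = m%:E -> 'V_Pr[f]%E = v%:E ->
  ('E_Pr[fun w => ((a * f w - b) ^+ 2)%R] =
   (a ^+ 2 * v + (a * m - b) ^+ 2)%:E)%E.
Proof.
move=> f2 fm fv; pose U : T -> R := (a \o* f) \+ cst (- b).
have af2 : a \o* f \in Lfun Pr 2%:E by apply: Lfun_scale => //; rewrite ler1n.
have VU : 'V_Pr[U]%E = (a ^+ 2 * v)%:E.
  by rewrite varianceD_cst_r// varianceZ// fv.
have EU : 'E_Pr[U]%E = (a * m - b)%:E.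
  rewrite expectationD ?Lfun_cst ?Lfun2_subset1//.
  by rewrite expectationZl ?Lfun2_subset1// fm expectation_cst.
have := varianceE (Lfun2_affine f a (- b) f2); rewrite -/U VU EU => VE.
rewrite (_ : (fun w => _) = (U ^+ 2)%R); last first.
  by apply/funext => w; rewrite /U !fctE /= mulrC.
by rewrite EFinD VE -EFin_expe subeK.
Qed.

End square_integrable.

(** * Mean and variance of a variable with a normal law *)

Section normal_law.
Context d (T : measurableType d) (R : realType) (Pr : probability T R).
Context (Z : {RV Pr >-> R}) (m s : R) (s0 : 0 < s).
Hypothesis Zlaw : has_normal_law Z m s.

Lemma ge0_integral_normal_law (f : R -> \bar R) :
    measurable_fun [set: R] f -> (forall x, 0 <= f x)%E ->
  (\int[Pr]_w f (Z w) = \int[normal_prob m s]_x f x)%E.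
Proof.
move=> mf f0.
have mZ : measurable_fun [set: T] (Z : T -> measurableTypeR R).
  exact: (measurable_funPT Z).
(* [R] and [measurableTypeR R] have the same measurable sets, but different
   displays. *)
pose hZ := isMeasurableFun.Build _ _ _ _ (Z : T -> measurableTypeR R) mZ.
pose Z' : {mfun T >-> measurableTypeR R} :=
  HB.pack (Z : T -> measurableTypeR R) hZ.
rewrite -[LHS](@ge0_integral_distribution _ _ _ _ _ Pr Z' f)//.
by apply: eq_measure_integral => A mA _; exact: Zlaw.
Qed.

Let mcenter : measurable_fun [set: R] (fun x => x - m).
Proof. exact: measurable_funB. Qed.

Lemma integral_sqr_normal_law :
  (\int[Pr]_w ((Z w - m) ^+ 2)%:E = (s ^+ 2)%:E)%E.
Proof.
rewrite (ge0_integral_normal_law (fun x => ((x - m) ^+ 2)%:E)).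
- exact: integral_sqr_normal_prob.
- by apply/measurable_EFinP; exact: measurable_funX.
- by move=> x; rewrite lee_fin sqr_ge0.
Qed.

(** The centred variable has the finite second moment [s ^+ 2], and adding back the constant [m]
    stays in [L^2]. *)
Lemma Lfun2_normal_law : (Z : T -> R) \in Lfun Pr 2%:E.
Proof.
have -> : (Z : T -> R) = 1 \o* (fun w => Z w - m) \+ cst m.
  by apply/funext => w /=; rewrite mulr1 subrK.
apply: Lfun2_affine; apply: sqr_integral_lty_Lfun2.
  exact: measurable_funB.
by rewrite integral_sqr_normal_law ltry.
Qed.

(** For [W = Z - m], the nonnegative variables [W + |W|] and [|W|] can be integrated against the
    normal law, where their integrals coincide. As [E|W|] is finite, it cancels and leaves
    [E W = 0]. *)
Lemma expectation_normal_law : 'E_Pr[Z]%E = m%:E.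
Proof.
pose W w := Z w - m.
have W1 : W \in Lfun Pr 1%E.
  apply: Lfun2_subset1.
  rewrite (_ : W = (1 \o* (Z : T -> R)) \+ cst (- m)).
    by apply: Lfun2_affine; exact: Lfun2_normal_law.
  by apply/funext => w /=; rewrite mulr1.
have nW1 : Num.norm \o W \in Lfun Pr 1%E by exact: Lfun_norm.
have EW : 'E_Pr[W \+ (Num.norm \o W)]%E = 'E_Pr[Num.norm \o W]%E.
  rewrite unlock.
  rewrite (ge0_integral_normal_law (fun x => (x - m + `|x - m|)%:E));
    first last.
  - by move=> x; rewrite lee_fin -lerBlDl sub0r -normrN ler_norm.
  - apply/measurable_EFinP; apply: measurable_funD => //.
    exact: measurableT_comp.
  rewrite (ge0_integral_normal_law (fun x => (`|x - m|)%:E)); first last.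
  - by move=> x; rewrite lee_fin.
  - by apply/measurable_EFinP; exact: measurableT_comp.
  exact: integral_addr_norm_normal_prob.
have {}EW : 'E_Pr[W]%E = 0%E.
  rewrite expectationD// in EW.
  rewrite -[LHS](@addeK _ 'E_Pr[Num.norm \o W]%E) ?expectation_fin_num// EW.
  by rewrite subee ?expectation_fin_num.
rewrite (_ : (Z : T -> R) = W \+ cst m); last first.
  by apply/funext => w; rewrite /W /= subrK.
by rewrite expectationD ?Lfun_cst// EW expectation_cst add0e.
Qed.

Lemma variance_normal_law : 'V_Pr[Z]%E = (s ^+ 2)%:E.
Proof.
rewrite /variance unlock expectation_normal_law /= unlock.
exact: integral_sqr_normal_law.
Qed.

End normal_law.

(** * Linear combinations of uncorrelated variables *)

Section uncorrelated_sum.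
Context d (T : measurableType d) (R : realType) (Pr : probability T R).
Context (I : eqType) (Z : I -> T -> R) (c m : I -> R) (v : R).
Hypothesis Z2 : forall p, Z p \in Lfun Pr 2%:E.
Hypothesis EZ : forall p, 'E_Pr[Z p]%E = (m p)%:E.
Hypothesis VZ : forall p, 'V_Pr[Z p]%E = v%:E.
Hypothesis covZ : forall p q, p != q -> covariance Pr (Z p) (Z q) = 0%E.

(** The sum runs over a list, so that its moments follow by induction. *)
Let S (r : seq I) (w : T) : R := \sum_(p <- r) c p * Z p w.

Let S_nil : S [::] = cst 0.
Proof. by apply/funext => w; rewrite /S big_nil. Qed.

Let S_cons p r : S (p :: r) = (c p \o* Z p) \+ S r.
Proof. by apply/funext => w; rewrite /S big_cons /= [Z p w * _]mulrC. Qed.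

Let cZ2 p : c p \o* Z p \in Lfun Pr 2%:E.
Proof. by apply: Lfun_scale => //; rewrite ler1n. Qed.

Lemma Lfun2_sum r : S r \in Lfun Pr 2%:E.
Proof.
elim: r => [|p r IH]; first by rewrite S_nil Lfun_cst.
by rewrite S_cons; apply: (Lfun_addr_closed Pr (lee1n 2)).2.
Qed.

Lemma expectation_sumZ r : 'E_Pr[S r]%E = (\sum_(p <- r) c p * m p)%:E.
Proof.
elim: r => [|p r IH]; first by rewrite S_nil expectation_cst big_nil.
rewrite S_cons expectationD ?Lfun2_subset1 ?Lfun2_sum//.
by rewrite expectationZl ?Lfun2_subset1// IH EZ big_cons.
Qed.

Let covariance_sum0 q r : q \notin r -> covariance Pr (Z q) (S r) = 0%E.
Proof.
elim: r => [|p r IH]; first by rewrite S_nil covariance_cst_r.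
rewrite inE negb_or => /andP[qp qr]; rewrite S_cons covarianceDr ?Lfun2_sum//.
rewrite IH// covarianceZr ?Lfun2_mul_Lfun1 ?Lfun2_subset1//.
by rewrite covZ// mule0 adde0.
Qed.

(** As [r] has no repetition, its head is uncorrelated with the sum over its tail, and the cross
    term in the variance vanishes at each step. *)
Lemma variance_sum r : uniq r ->
  'V_Pr[S r]%E = (v * \sum_(p <- r) c p ^+ 2)%:E.
Proof.
elim: r => [|p r IH] /=.
  by rewrite S_nil variance_cst big_nil mulr0.
case/andP => pr ur; rewrite S_cons varianceD ?Lfun2_sum// IH// varianceZ// VZ.
rewrite covarianceZl ?Lfun2_mul_Lfun1 ?Lfun2_subset1 ?Lfun2_sum//.
rewrite covariance_sum0// !mule0 adde0 big_cons -EFinM -EFinD.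
by congr EFin; ring.
Qed.

End uncorrelated_sum.

(** * Frobenius norm and orthogonal matrices *)

Section frobenius.
Context (R : realType).

Lemma frobenius_norm_sqr m n (A : 'M[R]_(m, n)) :
  frobenius_norm A ^+ 2 = \sum_i \sum_j A i j ^+ 2.
Proof.
by rewrite sqr_sqrtr//; do 2 (apply: sumr_ge0 => ? _); exact: sqr_ge0.
Qed.

Lemma frobenius_norm_sqr_trace m n (A : 'M[R]_(m, n)) :
  frobenius_norm A ^+ 2 = \tr (A *m A^T).
Proof.
rewrite frobenius_norm_sqr /mxtrace; apply: eq_bigr => i _.
by rewrite mxE; apply: eq_bigr => j _; rewrite mxE expr2.
Qed.

Lemma invmx_orthogonal n (P : 'M[R]_n) : orthogonal_matrix P -> invmx P = P^T.
Proof.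
move=> [PPT _]; have [uP _] := mulmx1_unit PPT.
by rewrite -[LHS]mulmx1 -PPT mulmxA mulVmx// mul1mx.
Qed.

(** In the trace form of the norm, [Q] cancels against its transpose directly and [P] after a cyclic
    permutation. *)
Lemma frobenius_norm_orthogonal m n (P : 'M[R]_m) (Q : 'M[R]_n)
    (A : 'M[R]_(m, n)) : orthogonal_matrix P -> orthogonal_matrix Q ->
  frobenius_norm (P *m A *m Q) ^+ 2 = frobenius_norm A ^+ 2.
Proof.
move=> [_ PTP] [QQT _]; rewrite !frobenius_norm_sqr_trace !trmx_mul.
by rewrite -!mulmxA (mulmxA Q) QQT mul1mx mxtrace_mulC -!mulmxA PTP mulmx1.
Qed.

Lemma orthogonal_matrix_tr n (P : 'M[R]_n) :
  orthogonal_matrix P -> orthogonal_matrix P^T.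
Proof. by move=> [P1 P2]; split; rewrite trmxK. Qed.

Lemma frobenius_norm_filter_estimator n k (P : 'M[R]_n) (Q : 'M[R]_k)
    (Theta M X : 'M[R]_(n, k)) :
    orthogonal_matrix P -> orthogonal_matrix Q ->
  frobenius_norm (filter_estimator P Q Theta M - X) ^+ 2 =
  \sum_i \sum_j
    (Theta i j * (P *m M *m Q) i j - (P *m X *m Q) i j) ^+ 2.
Proof.
move=> oP oQ; rewrite /filter_estimator !invmx_orthogonal//.
(* With [X] in this form, the error is [P^T (Theta . PMQ - PXQ) Q^T], the dot being the entrywise
   product, and the outer factors do not change the norm. *)
have -> : X = P^T *m (P *m X *m Q) *m Q^T.
  case: oP oQ => _ PTP [QQT _].
  by rewrite !mulmxA PTP mul1mx -mulmxA QQT mulmx1.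
rewrite -mulmxBl -mulmxBr frobenius_norm_orthogonal; last 2 first.
- exact: orthogonal_matrix_tr.
- exact: orthogonal_matrix_tr.
rewrite frobenius_norm_sqr; apply: eq_bigr => i _; apply: eq_bigr => j _.
(* The rewriting of [X] has also affected the right-hand side; orthogonality restores [P X Q]
   there. *)
rewrite !mulmxA; congr (_ ^+ 2).
case: oP oQ => PPT _ [_ QTQ].
by rewrite PPT mul1mx -!(mulmxA _ Q^T) QTQ mulmx1 !mxE.
Qed.

Lemma orthogonal_matrix_row n (P : 'M[R]_n) i : orthogonal_matrix P ->
  \sum_j P i j ^+ 2 = 1.
Proof.
move=> [PPT _]; have := congr1 (fun A : 'M[R]_n => A i i) PPT.
by rewrite !mxE eqxx /= mulr1n => <-; apply: eq_bigr => j _; rewrite mxE expr2.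
Qed.

Lemma orthogonal_matrix_col n (P : 'M[R]_n) j : orthogonal_matrix P ->
  \sum_i P i j ^+ 2 = 1.
Proof.
move=> /orthogonal_matrix_tr /(orthogonal_matrix_row _ _ j) <-.
by apply: eq_bigr => i _; rewrite mxE.
Qed.

(** Exhibits an entry of [P M Q] as a linear combination indexed by pairs, the form needed for sums
    of uncorrelated variables. *)
Lemma mulmx_mulmxE m n (P : 'M[R]_m) (M : 'M[R]_(m, n)) (Q : 'M[R]_n) a b :
  (P *m M *m Q) a b = \sum_(p : 'I_m * 'I_n) P a p.1 * Q p.2 b * M p.1 p.2.
Proof.
rewrite -(pair_bigA _ (fun i j => P a i * Q j b * M i j)) exchange_big /= mxE.
apply: eq_bigr => j _; rewrite mxE mulr_suml; apply: eq_bigr => i _.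
by rewrite mulrAC.
Qed.

End frobenius.

(** * The risk as a sum over the entries *)

Section risk.
Context (R : realType) (d : measure_display) (T : measurableType d).
Context (Pr : probability T R) (n k : nat) (sigma : R) (X : 'M[R]_(n, k)).
Context (Y : 'I_n * 'I_k -> {RV Pr >-> R}) (P : 'M[R]_n) (Q : 'M[R]_k).
Hypothesis sigma_gt0 : 0 < sigma.
Hypothesis Yind : mutually_independent Y.
Hypothesis Ylaw : forall i j, has_normal_law (Y (i, j)) (X i j) sigma.
Hypotheses (oP : orthogonal_matrix P) (oQ : orthogonal_matrix Q).

Let Ylaw' p : has_normal_law (Y p) (X p.1 p.2) sigma.
Proof. by case: p => i j; exact: Ylaw. Qed.

Let Y2 p : (Y p : T -> R) \in Lfun Pr 2%:E.
Proof. exact: Lfun2_normal_law (Ylaw' p). Qed.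

Let EY p : 'E_Pr[Y p]%E = (X p.1 p.2)%:E.
Proof. exact: expectation_normal_law (Ylaw' p). Qed.

Let covY p q : p != q -> covariance Pr (Y p) (Y q) = 0%E.
Proof.
move=> pq.
have Y1 r : (Y r : T -> R) \in Lfun Pr 1%E by apply: Lfun2_subset1; exact: Y2.
have Ypq : (Y p * Y q : T -> R) \in Lfun Pr 1%E.
  by apply: Lfun2_mul_Lfun1; exact: Y2.
rewrite covarianceE// expectationM_indep//.
  by rewrite subee// fin_numM ?expectation_fin_num.
(* Mutual independence is applied to the subfamily [{p, q}], with [A] attached to [p] and [B] to
   every other index, [q] included. *)
move=> A B mA mB; pose C r := if r == p then A else B.
have mC r : measurable (C r) by rewrite /C; case: ifP.
have qp : (q == p) = false by rewrite eq_sym; exact: negbTE.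
have := Yind [set p; q]%SET C mC; rewrite big_setU1 ?inE//= big_set1.
rewrite /C eqxx qp => <-; congr (Pr _).
apply/seteqP; split => w /=.
  by move=> [wA wB] r /=; rewrite !inE => /orP[]/eqP ->; rewrite ?eqxx ?qp.
move=> wC; have /= := wC p; have /= := wC q.
by rewrite !inE !eqxx orbT qp => /(_ isT) ? /(_ isT) ?; split.
Qed.

Lemma risk_entry (i : 'I_n) (j : 'I_k) (t z : R) :
  ('E_Pr[fun w => ((t * (P *m sample_matrix Y w *m Q) i j - z) ^+ 2)%R] =
   (t ^+ 2 * sigma ^+ 2 + (t * (P *m X *m Q) i j - z) ^+ 2)%:E)%E.
Proof.
pose c (p : 'I_n * 'I_k) : R := P i p.1 * Q p.2 j.
pose L (w : T) : R := \sum_(p <- index_enum _) c p * Y p w.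
have LE w : (P *m sample_matrix Y w *m Q) i j = L w.
  by rewrite mulmx_mulmxE; apply: eq_bigr => -[a b] _; rewrite mxE.
have EL : 'E_Pr[L]%E = ((P *m X *m Q) i j)%:E.
  by rewrite mulmx_mulmxE (expectation_sumZ _ _ _ _ _ _ c _ Y2 EY).
(* The sum factors into the squared norms of row [i] of [P] and column [j] of [Q], both equal to
   1. *)
have sumc : \sum_p c p ^+ 2 = 1.
  rewrite -(pair_bigA _ (fun a b => (P i a * Q b j) ^+ 2))/=.
  under eq_bigr do under eq_bigr do rewrite exprMn.
  under eq_bigr do rewrite -mulr_sumr orthogonal_matrix_col// mulr1.
  exact: orthogonal_matrix_row.
have VL : 'V_Pr[L]%E = (sigma ^+ 2)%:E.
  rewrite (variance_sum _ _ _ _ _ _ c (sigma ^+ 2) Y2 _ covY);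
    rewrite ?index_enum_uniq ?sumc ?mulr1//.
  by move=> p; exact: variance_normal_law (Ylaw' p).
under eq_fun do rewrite LE.
by apply: expectation_sqr_affine => //; exact: Lfun2_sum.
Qed.

Lemma risk_diagonal (Theta : 'M[R]_(n, k)) :
  risk Y P Q X Theta = (\sum_i \sum_j
    (Theta i j ^+ 2 * sigma ^+ 2
     + (Theta i j * (P *m X *m Q) i j - (P *m X *m Q) i j) ^+ 2))%:E.
Proof.
rewrite /risk.
under eq_fun do rewrite frobenius_norm_filter_estimator//.
pose g i j w :=
  (Theta i j * (P *m sample_matrix Y w *m Q) i j - (P *m X *m Q) i j) ^+ 2.
have mg i j : measurable_fun [set: T] (fun w => (g i j w)%:E).
  apply/measurable_EFinP/measurable_funX/measurable_funB => //.
  apply: measurable_funM => //; under eq_fun do rewrite mulmx_mulmxE.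
  apply: measurable_sum => p; apply: measurable_funM => //.
  under eq_fun do rewrite mxE -surjective_pairing.
  exact: measurable_funPT.
have g0 i j w : (0 <= (g i j w)%:E)%E by rewrite lee_fin sqr_ge0.
(* The integrands are nonnegative and measurable, so the integral commutes with the finite sums. *)
transitivity (\sum_i \sum_j \int[Pr]_w (g i j w)%:E)%E.
  rewrite unlock; under eq_integral do rewrite -sumEFin.
  rewrite ge0_integral_sum//; last 2 first.
  - move=> i; under eq_fun do rewrite -sumEFin.
    by apply: emeasurable_sum => j; exact: mg.
  - by move=> i w _; rewrite lee_fin sumr_ge0// => j _; exact: sqr_ge0.
  apply: eq_bigr => i _; under eq_integral do rewrite -sumEFin.
  by rewrite ge0_integral_sum// => j *; [exact: mg|exact: g0].
rewrite -sumEFin; apply: eq_bigr => i _.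
rewrite -sumEFin; apply: eq_bigr => j _.
by rewrite -risk_entry unlock.
Qed.

End risk.

(** * Completing the square and the unique minimiser *)

Lemma shrinkage_completing_square (R : realType) (sigma z t : R) : 0 < sigma ->
  t ^+ 2 * sigma ^+ 2 + (t * z - z) ^+ 2 =
  sigma ^+ 2 * z ^+ 2 / (sigma ^+ 2 + z ^+ 2)
  + (sigma ^+ 2 + z ^+ 2) * (t - z ^+ 2 / (sigma ^+ 2 + z ^+ 2)) ^+ 2.
Proof.
move=> s0; field.
(* The denominator [sigma^2 + z^2] is positive even at [z = 0], because [sigma > 0]. *)
by rewrite gt_eqF// ltr_wpDr ?sqr_ge0// exprn_gt0.
Qed.

Theorem proposition10 (R : realType) (d : measure_display)
    (T : measurableType d) (Pr : probability T R)
    (n k : nat) (hn : (1 <= n)%N) (hk : (1 <= k)%N)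
    (sigma : R) (hsigma : 0 < sigma)
    (X : 'M[R]_(n, k))
    (Y : 'I_n * 'I_k -> {RV Pr >-> R})
    (hYind : mutually_independent Y)
    (hYlaw : forall (i : 'I_n) (j : 'I_k),
      has_normal_law (Y (i, j)) (X i j) sigma)
    (P : 'M[R]_n) (Q : 'M[R]_k)
    (hP : orthogonal_matrix P) (hQ : orthogonal_matrix Q) :
  argmin (fun Theta : 'M[R]_(n, k) => risk Y P Q X Theta) =
  [set let S := hadamard (P *m X *m Q) (P *m X *m Q) in
       hdiv S (map_mx (fun x => sigma ^+ 2 + x) S)].
Proof.
set Opt := (let S := _ in _).
pose z := P *m X *m Q.
(* The risk splits into [best], which does not depend on [Theta], and [gap], a weighted sum of
   squares with positive weights that is 0 exactly at [Opt]. *)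
pose gap (Theta : 'M[R]_(n, k)) : R :=
  \sum_i \sum_j (sigma ^+ 2 + z i j ^+ 2) * (Theta i j - Opt i j) ^+ 2.
pose best : R :=
  \sum_i \sum_j sigma ^+ 2 * z i j ^+ 2 / (sigma ^+ 2 + z i j ^+ 2).
have coef_gt0 i j : 0 < sigma ^+ 2 + z i j ^+ 2.
  by rewrite ltr_wpDr ?sqr_ge0// exprn_gt0.
have riskE Theta : risk Y P Q X Theta = (best + gap Theta)%:E.
  rewrite (risk_diagonal _ _ _ _ _ _ sigma)// -big_split; congr EFin.
  apply: eq_bigr => i _.
  rewrite -big_split; apply: eq_bigr => j _ /=.
  by rewrite shrinkage_completing_square// /Opt !mxE -!expr2.
have term_ge0 Theta i j :
    0 <= (sigma ^+ 2 + z i j ^+ 2) * (Theta i j - Opt i j) ^+ 2.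
  by rewrite mulr_ge0 ?sqr_ge0// ltW.
have gapOpt : gap Opt = 0.
  by do 2 (apply: big1 => ? _); rewrite subrr expr0n mulr0.
apply/seteqP; split => [ Theta minT|? -> Theta]; last first.
  rewrite !riskE gapOpt lee_fin lerD2l /gap.
  by do 2 (apply: sumr_ge0 => ? _); exact: term_ge0.
(* Comparing a minimiser with [Opt] gives [gap Theta <= 0]. A sum of nonnegative terms that is 0 has
   all its terms 0, which forces equality with [Opt] entry by entry. *)
have : gap Theta == 0.
  rewrite eq_le; apply/andP; split.
    by have := minT Opt; rewrite !riskE gapOpt lee_fin lerD2l.
  by do 2 (apply: sumr_ge0 => ? _); exact: term_ge0.
rewrite /gap psumr_eq0 => [/allP gap0|i _]; last by apply: sumr_ge0.
apply/matrixP => i j; have /= := gap0 i (mem_index_enum _).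
rewrite psumr_eq0 => [/allP/(_ j (mem_index_enum _))/=|? _]; last first.
  exact: term_ge0.
by rewrite mulf_eq0 gt_eqF//= sqrf_eq0 subr_eq0 => /eqP.
Qed.
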